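(* Let $A$ and $B_z$ be positive definite Hermitian operators on $V$, let $z\in\mathbb C$ with $\phi:=\arg z\in(-\pi,\pi)$, let $w$ be the solution of $A_zw=g$ where $A_z:=zI+A$, and let $w_n$ be the $n$th iterate of the CG method preconditioned by $B_z$. Then $$|||w_n-w|||\le\sec(\tfrac12\phi)\inf_{v\in w_0+\widetilde V_n}|||v-w|||.$$
   Context: $V$ is a finite-dimensional complex inner product space with inner product $(\cdot,\cdot)$ and norm $\|\cdot\|$. The norm is $|||v|||^2:=|z|\,\|v\|^2+(Av,v)$. Given $g,w_0\in V$, put $G_z:=B_zA_z$ and $\widetilde r_0:=B_z(g-A_zw_0)$; the Krylov subspaces are $\widetilde V_0:=\{0\}$ and $\widetilde V_n:=\operatorname{span}\{\widetilde r_0,G_z\widetilde r_0,\dots,G_z^{n-1}\widetilde r_0\}$ for $n\ge1$. The preconditioned CG iterate is the unique $w_n=w_0+v_n$, $v_n\in\widetilde V_n$, with $(A_zw_n,\varphi)=(g,\varphi)$ for all $\varphi\in\widetilde V_n$. *)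

(* Defs.v *)
From HB Require Import structures.
From mathcomp Require Import all_boot all_order all_algebra.
From mathcomp Require Import sesquilinear.
From mathcomp Require Import complex.
From mathcomp Require Import classical_sets reals trigo.

Set Implicit Arguments.
Unset Strict Implicit.
Unset Printing Implicit Defensive.

Import Order.TTheory GRing.Theory Num.Theory.
Local Open Scope ring_scope.
Local Open Scope complex_scope.
Local Open Scope classical_set_scope.

Definition sec (R : realType) (x : R) : R := (cos x)^-1.

(* arg 0 is left undefined: no phi is related to z = 0. *)
Definition is_arg (R : realType) (z : R[i]) (phi : R) : Prop :=
  [/\ z != 0, - pi < phi <= pi & z = `|z| * (cos phi +i* sin phi)].

Section InnerProductSpace.
Variables (R : realType) (V : vectType R[i]).

(* The inner product is linear in its first argument, conjugate-linear in its
   second; "0 < x" in R[i] means that x is real and positive. *)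
Variable dot : {dot V for Num.conj}.

Implicit Types (A B : 'End(V)) (z : R[i]) (u v w g : V).

Definition hermitian_op A : Prop := forall u v, dot (A u) v = dot u (A v).

Definition posdef_op A : Prop := forall v, v != 0 -> 0 < dot (A v) v.

Definition shift z A : 'End(V) := z *: \1%VF + A.

Definition vnorm v : R := Num.sqrt (complex.Re (dot v v)).

(* The real part only casts to R: both |z| and, for Hermitian A, (A v, v) are
   real. *)
Definition enorm z A v : R :=
  Num.sqrt (complex.Re `|z| * vnorm v ^+ 2 + complex.Re (dot (A v) v)).

Definition prec_op z A B : 'End(V) := (B \o shift z A)%VF.

Definition prec_residual z A B g (w0 : V) : V := B (g - shift z A w0).

Definition krylov z A B g (w0 : V) (n : nat) : {vspace V} :=
  <<mkseq (fun k => iter k (prec_op z A B) (prec_residual z A B g w0)) n>>%VS.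

Definition is_pcg_iterate z A B g (w0 : V) (n : nat) (wn : V) : Prop :=
  wn - w0 \in krylov z A B g w0 n /\
  forall phi, phi \in krylov z A B g w0 n -> dot (shift z A wn) phi = dot g phi.

End InnerProductSpace.

(* Main.v *)
Require Import Defs.
From HB Require Import structures.
From mathcomp Require Import all_boot all_order all_algebra.
From mathcomp Require Import sesquilinear.
From mathcomp Require Import complex.
From mathcomp Require Import classical_sets reals trigo.
From mathcomp Require Import ring lra.

Set Implicit Arguments.
Unset Strict Implicit.
Unset Printing Implicit Defensive.

Import Order.TTheory GRing.Theory Num.Theory.
Local Open Scope ring_scope.
Local Open Scope complex_scope.
Local Open Scope classical_set_scope.

(** Write [e := wn - w] and [d := v - w] for any competitor [v] in the affine
    space [w0 + Vn], and [E], [D] for their energy norms.  The error satisfies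
    the Galerkin orthogonality [(A_z e, f) = 0] for every [f] in [Vn], and
    [e - d] lies in [Vn], so [(A_z e, e) = (A_z e, d)].

    With [z = |z| p^2], where [p] has modulus 1 and argument [phi / 2], one has
    [conj p * (A_z x, y) = |z| p (x, y) + conj p (A x, y)].  For [x = y = e] the
    real part is [c E^2] with [c := cos (phi / 2) > 0]: the rotation by
    [- phi / 2] balances the arguments of the two terms (lemma
    [rotated_form_enorm]).  For [x = e], [y = d], instead of Cauchy-Schwarz the
    expansion of [(T (a e - d), a e - d) >= 0] is used for the identity
    with [a = c p] and for [A] with [a = c conj p], as [|a| = c] in both cases
    (lemma [posform_cross_le]); [|z|] times the first estimate plus the second
    is [2 c Re (conj p (A_z e, d)) <= c^2 E^2 + D^2] (lemma [rotated_form_le]).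
    Hence [2 c^2 E^2 <= c^2 E^2 + D^2], that is, [c E <= D]; it remains to
    take the infimum over [v]. *)

Section EnergyNorm.
Variables (R : realType) (V : vectType R[i]) (dot : {dot V for Num.conj}).
Implicit Types (A T : 'End(V)) (z : R[i]) (u v : V).

Let ReD (x y : R[i]) : complex.Re (x + y) = complex.Re x + complex.Re y.
Proof. by case: x; case: y. Qed.

Lemma Re_dot_ge0 u : 0 <= complex.Re (dot u u).
Proof. by have := dnorm_ge0 dot u; rewrite lecE /= => /andP[]. Qed.

Lemma posdef_Re_ge0 A v : posdef_op dot A -> 0 <= complex.Re (dot (A v) v).
Proof.
move=> A_pos; have [->|v_neq0] := eqVneq v 0; first by rewrite linear0r.
by have := A_pos v v_neq0; rewrite ltcE /= => /andP[_ /ltW].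
Qed.

(** A weighted bound on the cross term of a positive semidefinite Hermitian
    form, from its nonnegativity at [a *: u - v]. *)
Lemma posform_cross_le T (a : R[i]) u v :
  hermitian_op dot T -> (forall x, 0 <= complex.Re (dot (T x) x)) ->
  2 * complex.Re (a * dot (T u) v) <=
    (complex.Re a ^+ 2 + complex.Im a ^+ 2) * complex.Re (dot (T u) u)
    + complex.Re (dot (T v) v).
Proof.
move=> T_herm /(_ (a *: u - v)).
have swap : dot (T v) u = conjc (dot (T u) v).
  by rewrite T_herm hermC expr0 mul1r.
have -> : T (a *: u - v) = a *: T u - T v by rewrite linearB linearZ.
rewrite linearBl !linearBr /= !linearZl_LR !linearZr_LR /=.
rewrite swap.
case: a => a1 a2; case: (dot (T u) u) => p1 p2; case: (dot (T v) v) => q1 q2.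
by case: (dot (T u) v) => x y /=; nra.
Qed.

Lemma enorm_sqr z A v : posdef_op dot A ->
  enorm dot z A v ^+ 2 =
    complex.Re `|z| * complex.Re (dot v v) + complex.Re (dot (A v) v).
Proof.
move=> A_pos; have z_ge0 : 0 <= complex.Re `|z|.
  by have := normr_ge0 z; rewrite lecE /= => /andP[].
rewrite /enorm /vnorm (sqr_sqrtr (Re_dot_ge0 v)) sqr_sqrtr // addr_ge0 //.
  by rewrite mulr_ge0 ?Re_dot_ge0.
exact: posdef_Re_ge0.
Qed.

Lemma dot_shift z A u v : dot (shift z A u) v = z * dot u v + dot (A u) v.
Proof.
by rewrite /shift add_lfunE scale_lfunE id_lfunE linearDl linearZl_LR.
Qed.

Section Rotation.
Variables (z : R[i]) (phi : R).
Hypothesis phi_arg : is_arg z phi.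

Let c := cos (phi / 2).
Let s := sin (phi / 2).

Let cs : c ^+ 2 + s ^+ 2 = 1. Proof. exact: cos2Dsin2. Qed.

(** Rotating [A_z] by half the argument of [z] makes its two summands rotate by
    opposite angles. *)
Lemma rotated_form A u v :
  (c -i* s) * dot (shift z A u) v =
    (complex.Re `|z|)%:C * ((c +i* s) * dot u v) + (c -i* s) * dot (A u) v.
Proof.
have [_ _ zE] := phi_arg.
have phi2 : phi = phi / 2 + phi / 2 by lra.
have cis2 : cos phi +i* sin phi = (c +i* s) * (c +i* s).
  rewrite {1 2}phi2 cosD sinD -/c -/s.
  by apply/eqP; rewrite eq_complex /= !eqxx /=; apply/eqP; ring.
have conj_cis : (c -i* s) * (c +i* s) = 1.
  apply/eqP; rewrite eq_complex /=; apply/andP; split; apply/eqP.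
    by rewrite -cs; ring.
  by ring.
rewrite dot_shift mulrDr; congr (_ + _).
rewrite {1}zE cis2 RRe_real ?normr_real //.
transitivity ((c -i* s) * (c +i* s) * (`|z| * ((c +i* s) * dot u v))).
  by ring.
by rewrite conj_cis mul1r.
Qed.

Lemma rotated_form_enorm A v : hermitian_op dot A -> posdef_op dot A ->
  complex.Re ((c -i* s) * dot (shift z A v) v) = c * enorm dot z A v ^+ 2.
Proof.
move=> A_herm A_pos; rewrite rotated_form ReD enorm_sqr //.
have dot_im : complex.Im (dot v v) = 0 by apply: ger0_Im; exact: dnorm_ge0.
have A_im : complex.Im (dot (A v) v) = 0.
  have [->|v_neq0] := eqVneq v 0; first by rewrite linear0r.
  by apply: ger0_Im; apply: ltW; exact: A_pos.
move: dot_im A_im; case: (dot v v) => x y; case: (dot (A v) v) => x' y' /= -> ->.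
by ring.
Qed.

Lemma rotated_form_le A u v : hermitian_op dot A -> posdef_op dot A ->
  2 * c * complex.Re ((c -i* s) * dot (shift z A u) v) <=
    c ^+ 2 * enorm dot z A u ^+ 2 + enorm dot z A v ^+ 2.
Proof.
move=> A_herm A_pos.
have z_ge0 : 0 <= complex.Re `|z|.
  by have := normr_ge0 z; rewrite lecE /= => /andP[].
have id_herm : hermitian_op dot \1%VF by move=> x y; rewrite !id_lfunE.
have id_ge0 x : 0 <= complex.Re (dot (\1%VF x) x).
  by rewrite id_lfunE Re_dot_ge0.
have A_ge0 x : 0 <= complex.Re (dot (A x) x) by exact: posdef_Re_ge0.
have h1 := posform_cross_le (c%:C * (c +i* s)) u v id_herm id_ge0.
have h2 := posform_cross_le (c%:C * (c -i* s)) u v A_herm A_ge0.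
have {h1} := ler_wpM2l z_ge0 h1.
move: h2; rewrite rotated_form ReD !enorm_sqr // !id_lfunE /=.
(* Both weights have squared modulus c^2. *)
have -> : (c * c - 0 * s) ^+ 2 + (c * s + 0 * c) ^+ 2 = c ^+ 2.
  by rewrite -[RHS]mulr1 -cs; ring.
have -> : (c * c - 0 * - s) ^+ 2 + (c * - s + 0 * c) ^+ 2 = c ^+ 2.
  by rewrite -[RHS]mulr1 -cs; ring.
case: (dot u v) => x y; case: (dot (A u) v) => x' y' /=.
by lra.
Qed.

End Rotation.

End EnergyNorm.

Theorem proposition3p7 (R : realType) (V : vectType R[i])
  (dot : {dot V for Num.conj}) (A Bz : 'End(V)) (z : R[i]) (phi : R)
  (g w w0 : V) (n : nat) (wn : V)
  (A_herm : hermitian_op dot A) (A_pos : posdef_op dot A)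
  (B_herm : hermitian_op dot Bz) (B_pos : posdef_op dot Bz)
  (phi_arg : is_arg z phi) (phi_lt : - pi < phi < pi)
  (w_sol : shift z A w = g)
  (wn_iter : is_pcg_iterate dot z A Bz g w0 n wn) :
  enorm dot z A (wn - w) <=
    sec (phi / 2) *
    inf [set enorm dot z A (v - w) | v in
           [set v | v - w0 \in krylov z A Bz g w0 n]].
Proof.
have [wn_in wn_orth] := wn_iter.
have c_gt0 : 0 < cos (phi / 2).
  by apply: cos_gt0_pihalf; case/andP: phi_lt => *; apply/andP; split; lra.
rewrite /sec ler_pdivlMl //; apply: lb_le_inf.
  by exists (enorm dot z A (wn - w)), wn.
move=> _ [v /= v_in <-].
have galerkin : dot (shift z A (wn - w)) (wn - w)
              = dot (shift z A (wn - w)) (v - w).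
  apply/eqP; rewrite -subr_eq0 -linearBr /=.
  have -> : wn - w - (v - w) = (wn - w0) - (v - w0) by rewrite !opprB !subrKA.
  have -> : shift z A (wn - w) = shift z A wn - g by rewrite linearB /= w_sol.
  by rewrite linearBl /= wn_orth ?subrr // rpredB.
have := rotated_form_le phi_arg (wn - w) (v - w) A_herm A_pos.
rewrite -galerkin (rotated_form_enorm phi_arg) // => le_ED.
have {le_ED} : (cos (phi / 2) * enorm dot z A (wn - w)) ^+ 2
               <= enorm dot z A (v - w) ^+ 2 by rewrite exprMn; lra.
by rewrite ler_pXn2r // nnegrE ?mulr_ge0 ?sqrtr_ge0 // ltW.
Qed.
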